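(* Let $X\in\mathbb{R}^{m\times n}$ have $\mathrm{rank}(X)=n$ and singular values $\sigma_1(X)\ge\cdots\ge\sigma_n(X)\ge 1$. Let $k$ be a fixed integer with $0<k<n$. Let $X_k^*\in\mathbb{R}^{m\times k}$ be a column submatrix of $X$ that maximizes $\log\mathrm{vol}(B)$ among all column submatrices $B\in\mathbb{R}^{m\times k}$ of $X$. Then the Businger–Golub QR column selection algorithm is a greedy algorithm for maximizing the log-volume, that is, in each step $j=1,\ldots,k$ the selected index $t$ maximizes $\log\mathrm{vol}(X_{\mathcal{S}_{j-1}\cup\{t\}})$ over all $t\in\{1,\ldots,n\}-\mathcal{S}_{j-1}$; and its output matrix $X_k\equiv X_{\mathcal{S}_k}$ satisfies $$0\le\log\mathrm{vol}(X_k^* )-\log\mathrm{vol}(X_k)\le\left(1-\tfrac1k\right)^k\log\mathrm{vol}(X_k^* ),$$ where $(1-\tfrac1k)^k\le\tfrac1e<.37$. Moreover, the upper bound is tight (holds with equality) for matrices $X$ with orthonormal columns.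
   Context: For $\mathcal{S}\subset\{1,\ldots,n\}$, $X_{\mathcal{S}}$ is the submatrix of $X$ consisting of the columns indexed by $\mathcal{S}$. For a matrix $B$ with full column rank, $\mathrm{vol}(B)=\sqrt{\det(B^TB)}$, the product of its singular values; the volume of the empty matrix is $1$, so its log-volume is $0$. Businger–Golub QR column selection (QR with column pivoting). Input: $X\in\mathbb{R}^{m\times n}$ with columns $x_1,\ldots,x_n$, and an integer $0<k\le\mathrm{rank}(X)$. Set $P_0=0\in\mathbb{R}^{m\times m}$, $\mathcal{S}_0=\emptyset$, $\mathcal{T}_0=\{1,\ldots,n\}$. For $j=1,\ldots,k$: select $t\in\mathcal{T}_{j-1}$ with $\|(I-P_{j-1})x_t\|=\max_{i\in\mathcal{T}_{j-1}}\|(I-P_{j-1})x_i\|$ (Euclidean norm); set $\mathcal{S}_j=\mathcal{S}_{j-1}\cup\{t\}$, $\mathcal{T}_j=\mathcal{T}_{j-1}-\{t\}$, $y_j=(I-P_{j-1})x_t$, and $P_j=P_{j-1}+y_jy_j^\dagger$ with $y_j^\dagger=y_j^T/\|y_j\|^2$. Output: the $m\times k$ column submatrix $X_{\mathcal{S}_k}$. *)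

(* Defs.v *)
From mathcomp Require Import all_boot all_order all_algebra.
From mathcomp Require Import reals sequences exp.

Set Implicit Arguments.
Unset Strict Implicit.
Unset Printing Implicit Defensive.

Import Order.TTheory GRing.Theory Num.Theory.

Local Open Scope ring_scope.

(* The library norm `|v| on matrices is the max norm, hence
   this separate Euclidean one. *)
Definition enorm (R : realType) (m : nat) (v : 'cV[R]_m) : R :=
  Num.sqrt (\sum_i v i 0 ^+ 2).

(* sigma lists the nonnegative square roots of the eigenvalues of X^T X, with
   multiplicity, in nonincreasing order.  There are n of them: when m < n the
   list is the usual one padded with n - m zeros. *)
Definition singular_values (R : realType) (m n : nat) (X : 'M[R]_(m, n))
    (sigma : 'I_n -> R) : Prop :=
  [/\ forall i, 0 <= sigma i,
      forall i j : 'I_n, (i <= j)%N -> sigma j <= sigma i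
    & char_poly (X^T *m X) = \prod_i ('X - (sigma i ^+ 2)%:P)].

Definition colsubmx (R : realType) (m n : nat) (X : 'M[R]_(m, n))
    (S : {set 'I_n}) : 'M[R]_(m, #|S|) :=
  colsub (fun j : 'I_#|S| => enum_val j) X.

Definition vol (R : realType) (m k : nat) (B : 'M[R]_(m, k)) : R :=
  Num.sqrt (\det (B^T *m B)).

Definition logvol (R : realType) (m k : nat) (B : 'M[R]_(m, k)) : R :=
  ln (vol B).

Definition max_logvol (R : realType) (m n : nat) (X : 'M[R]_(m, n)) (k : nat)
    (S : {set 'I_n}) : Prop :=
  #|S| = k /\
  forall S' : {set 'I_n}, #|S'| = k ->
    logvol (colsubmx X S') <= logvol (colsubmx X S).

Record bg_state (R : realType) (m n : nat) := BGState {
  bgP : 'M[R]_m;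
  bgS : {set 'I_n};
  bgT : {set 'I_n} }.

Definition bg_init (R : realType) (m n : nat) : bg_state R m n :=
  BGState 0 set0 setT.

Definition bg_residual (R : realType) (m n : nat) (X : 'M[R]_(m, n))
    (st : bg_state R m n) (i : 'I_n) : 'cV[R]_m :=
  (1%:M - bgP st) *m col i X.

Definition dagger (R : realType) (m : nat) (y : 'cV[R]_m) : 'rV[R]_m :=
  (enorm y ^+ 2)^-1 *: y^T.

Definition bg_step (R : realType) (m n : nat) (X : 'M[R]_(m, n))
    (st : bg_state R m n) (t : 'I_n) : bg_state R m n :=
  let y := bg_residual X st t in
  BGState (bgP st + y *m dagger y) (t |: bgS st) (bgT st :\ t).

Definition bg_after (R : realType) (m n : nat) (X : 'M[R]_(m, n))
    (s : seq 'I_n) : bg_state R m n :=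
  foldl (bg_step X) (bg_init R m n) s.

Definition bg_pivot (R : realType) (m n : nat) (X : 'M[R]_(m, n))
    (st : bg_state R m n) (t : 'I_n) : Prop :=
  t \in bgT st /\
  forall i, i \in bgT st ->
    enorm (bg_residual X st i) <= enorm (bg_residual X st t).

(* t is the list of indices selected in some k-step execution, under any
   resolution of ties.  Entry j : 'I_k of t is selected in step j + 1, from the
   state reached after the first j selections. *)
Definition businger_golub (R : realType) (m n k : nat) (X : 'M[R]_(m, n))
    (t : k.-tuple 'I_n) : Prop :=
  forall j : 'I_k, bg_pivot X (bg_after X (take j t)) (tnth t j).

(* Main.v *)
Require Import Defs.
From mathcomp Require Import all_boot all_order all_fingroup all_algebra.
From mathcomp Require Import reals sequences exp.
From mathcomp Require Import complex lra.

(** Put F S = logvol (X_S).  If P is the orthogonal projector onto the span of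
    the columns in S, adding a column x to S multiplies the volume by the length
    of the residual (1 - P) x (vol_setU1), so that
    F (i |: S) - F S = ln |(1 - P) x_i|.  The theorem follows from reading
    properties of F off the residuals.

    - The pivot rule picks the largest residual, so it picks the largest
      increase of F (bg_pivot_logvol_max).  Here one uses that the matrix P_j of
      the algorithm is the projector onto the columns selected so far, which
      each rank-one update preserves (bg_step_projector).
    - F is submodular: a projector onto a larger span leaves a shorter residual
      (enorm_complement_sub, logvol_submodular).
    - F is monotone: the residual of a new column x_i is X u with u_i = 1, and
      the singular values being at least 1 means |X u| >= |u| >= 1
      (singular_values_ge1_expand, enorm_residual_ge1, logvol_monotone).

    The bound is then the theorem of Nemhauser, Wolsey and Fisher on greedy
    maximization of a monotone submodular function (greedy_gap): if O is an
    optimal set of size k, adding its k elements to S_j one at a time shows that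
    the gap F O - F S_j is at most k times the gain of the next greedy step, so
    each step shrinks the gap by the factor 1 - 1/k.

    When the columns of X are orthonormal all volumes are 1, and both sides of
    the upper bound vanish. *)

Set Implicit Arguments.
Unset Strict Implicit.
Unset Printing Implicit Defensive.

Import Order.TTheory GRing.Theory Num.Theory.

Local Open Scope ring_scope.

(** * Greedy maximization of monotone submodular set functions *)

Section MonotoneSubmodular.
Variables (R : realFieldType) (T : finType) (F : {set T} -> R).
Hypothesis monoF : forall S i, F S <= F (i |: S).
Hypothesis submodF : forall (S S' : {set T}) i, S \subset S' -> i \notin S' ->
  F (i |: S') - F S' <= F (i |: S) - F S.

(** By monotonicity F O is at most the value at the union of O and S.  Adding the
    elements of O to S one at a time, submodularity bounds each gain by the gain
    obtained from adding the same element to S alone. *)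
Lemma monotone_submod_le_sum (S O : {set T}) :
  F O <= F S + \sum_(i in O) (F (i |: S) - F S).
Proof.
have monoU (A B : {set T}) : F A <= F (B :|: A).
  rewrite -(set_enum B); elim: (enum B) => [|i s /le_trans->//].
    by rewrite set_nil set0U.
  by rewrite set_cons -setUA.
apply: le_trans (monoU _ S) _; rewrite setUC -big_enum -{1}(set_enum O) /=.
elim: (enum O) => [|i s IHs]; first by rewrite set_nil set0U big_nil addr0.
rewrite big_cons set_cons -setUA addrCA.
have [si | nsi] := boolP (i \in [set x in s] :|: S).
  rewrite (setUidPr _) ?sub1set //; apply: le_trans IHs _.
  by rewrite lerDr subr_ge0.
by rewrite -[leLHS](subrK (F ([set x in s] :|: S))) lerD // submodF ?subsetUr.
Qed.

(** The Nemhauser-Wolsey-Fisher bound.  Each of the k terms of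
    monotone_submod_le_sum is at most the gain of the next greedy step, so every
    step closes at least a 1/k fraction of the remaining gap. *)
Lemma greedy_gap (O : {set T}) (S : nat -> {set T}) (k l : nat) :
    (0 < k)%N -> #|O| = k -> S 0 = set0 -> F set0 = 0 ->
    (forall j i, (j < l)%N -> F (i |: S j) <= F (S j.+1)) ->
  F O - F (S l) <= (1 - k%:R^-1) ^+ l * F O.
Proof.
move=> k_gt0 cardO S0 F0; elim: l => [|l IHl] greedyS.
  by rewrite S0 F0 subr0 expr0 mul1r.
have kR : 0 < k%:R :> R by rewrite ltr0n.
rewrite exprS -mulrA.
have q_ge0 : 0 <= 1 - k%:R^-1 :> R by rewrite subr_ge0 invf_le1 ?ler1n.
have gap_l : F O - F (S l) <= (1 - k%:R^-1) ^+ l * F O.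
  by apply: IHl => j i lt_jl; apply: greedyS; rewrite ltnW.
apply: le_trans (ler_wpM2l q_ge0 gap_l).
have le_sum : F O <= F (S l) + k%:R * (F (S l.+1) - F (S l)).
  apply: le_trans (monotone_submod_le_sum (S l) O) _.
  rewrite lerD2l -cardO mulr_natl -sumr_const.
  by apply: ler_sum => i _; rewrite lerB // greedyS.
(* Multiplying by k turns the goal into a linear rearrangement of le_sum. *)
rewrite -(ler_pM2l kR) [leRHS]mulrA.
have -> : k%:R * (1 - k%:R^-1) = k%:R - 1 :> R.
  by rewrite mulrBr mulr1 mulfV ?gt_eqF.
set f := F O in le_sum *; set a := F (S l) in le_sum *.
set b := F (S l.+1) in le_sum *; set c : R := k%:R in le_sum *; nra.
Qed.

End MonotoneSubmodular.

(** * The constant (1 - 1/k)^k *)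

(** Five terms of the exponential series give 65/24 = 2.708..., just above
    100/37 = 2.7027...; four terms would not suffice. *)
Lemma expR1_gt (R : realType) : 100 / 37 < expR (1 : R).
Proof.
have sum_le : series (exp_coeff (1 : R)) 5 <= expR 1.
  apply: nondecreasing_cvgn_le (is_cvg_series_exp_coeff _) _.
  by apply: nondecreasing_series => i _ _; exact: exp_coeff_ge0.
apply: lt_le_trans sum_le.
have coeffE n : exp_coeff (1 : R) n = n`!%:R^-1.
  by rewrite /exp_coeff /= expr1n div1r.
rewrite /series /= !big_nat_recr // big_geq // !coeffE.
rewrite (_ : 2`! = 2)%N // (_ : 3`! = 6)%N // (_ : 4`! = 24)%N //.
by rewrite (_ : 1`! = 1)%N // fact0 /=; lra.
Qed.

(** The k-th power of 1 - 1/k <= exp (- 1/k). *)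
Lemma pow_one_sub_inv_le (R : realType) (k : nat) : (0 < k)%N ->
  (1 - k%:R^-1) ^+ k <= (expR (1 : R))^-1.
Proof.
move=> k_gt0; have kR : k%:R != 0 :> R by rewrite pnatr_eq0 -lt0n.
have -> : (expR (1 : R))^-1 = expR (- k%:R^-1) ^+ k.
  by rewrite -expRM_natl mulrN mulfV // expRN.
apply: lerXn2r; rewrite ?nnegrE ?expR_ge0 ?expR_ge1Dx //.
by rewrite subr_ge0 invf_le1 ?ler1n ?ltr0n.
Qed.

(** * Rayleigh quotients of real symmetric matrices *)

(** Diagonalize A by a unitary matrix over the complex closure R[i]: a real
    symmetric matrix is Hermitian there, its spectrum is real and consists of
    roots of the characteristic polynomial of A.  In the unitary coordinates w
    of u the two sides are c * sum |w_i|^2 and sum d_i |w_i|^2. *)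
Lemma ler_rayleigh_root (R : rcfType) (n : nat) (A : 'M[R]_n) (c : R) :
    A^T = A -> (forall a, root (char_poly A) a -> c <= a) ->
  forall u : 'cV[R]_n, c * (u^T *m u) 0 0 <= (u^T *m A *m u) 0 0.
Proof.
move=> symA rootA u.
pose toC := real_complex R; pose AC := map_mx toC A.
have toC_real x : toC x \is Num.real by apply/complex_realP; exists x.
have real_mx p q (M : 'M[R]_(p, q)) : map_mx toC M \is a mxOver Num.real.
  by apply/mxOverP => i j; rewrite mxE.
have hermA : AC \is hermsymmx.
  apply: realsym_hermsym (real_mx _ _ _).
  apply/is_hermitianmxP; rewrite expr0 scale1r map_mx_id //.
  by rewrite /AC map_trmx symA.
have /orthomx_spectralP := hermitian_normalmx hermA.
have := spectral_unitarymx AC; have := spectral_unit AC.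
have := hermitian_spectral_diag_real hermA.
set P := spectralmx AC; set d := spectral_diag AC => realD unitP unitaryP defA.
have PAC : P *m AC = diag_mx d *m P.
  by rewrite [in LHS]defA !mulmxA mulmxV // mul1mx.
have le_c_d i : toC c <= d 0 i.
  have /complex_realP[a def_di] : d 0 i \is Num.real by exact: (mxOverP realD).
  rewrite def_di lecR; apply: rootA; rewrite -(fmorph_root toC) map_char_poly.
  rewrite -eigenvalue_root_char; apply/eigenvalueP; exists (row i P).
    by rewrite -row_mul PAC; apply/rowP => j; rewrite mul_diag_mx !mxE def_di.
  (* Row i of P is a left eigenvector: it is nonzero as P is invertible. *)
  apply: contraTneq unitP => rowP0; rewrite -row_free_unit.
  apply/negP => /row_freeP[Q /(congr1 (row i))]; rewrite row_mul rowP0 mul0mx.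
  move=> /rowP/(_ i)/eqP; rewrite !mxE eqxx eq_sym oner_eq0 //.
pose w := P *m map_mx toC u.
have wadj : map_mx toC u^T *m invmx P = (w ^t*)%sesqui.
  by rewrite invmx_unitary // /w trmx_mul map_mxM map_trmx [in RHS]realmxC.
have normw : toC ((u^T *m u) 0 0) = \sum_i `|w i 0| ^+ 2.
  transitivity (((w ^t*)%sesqui *m w) 0 0).
    by rewrite -wadj -mulmxA mulKmx // -map_mxM [RHS]mxE.
  by rewrite mxE; apply: eq_bigr => i _; rewrite !mxE normCK mulrC.
have quadw : toC ((u^T *m A *m u) 0 0) = \sum_i d 0 i * `|w i 0| ^+ 2.
  transitivity (((w ^t*)%sesqui *m (diag_mx d *m w)) 0 0).
    suff <- : map_mx toC (u^T *m A *m u) = (w ^t*)%sesqui *m (diag_mx d *m w).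
      by rewrite [RHS]mxE.
    by rewrite -wadj !map_mxM -/AC [X in _ *m X *m _]defA !mulmxA.
  rewrite mxE; apply: eq_bigr => i _; rewrite mul_diag_mx !mxE normCK.
  by rewrite mulrC -mulrA.
rewrite -lecR; have -> : (c * (u^T *m u) 0 0)%:C%C =
    toC c * toC ((u^T *m u) 0 0).
  by rewrite -rmorphM.
rewrite -/toC quadw normw mulr_sumr; apply: ler_sum => i _.
by rewrite ler_wpM2r // exprn_ge0.
Qed.

(** * Gram determinants *)

(** Allowing distinct p and q, equal only through h, is what makes this usable
    for the column submatrices of a set S, whose size is #|S|. *)
Lemma det_mxsub_bij (R : comNzRingType) (p q : nat) (h : 'I_p -> 'I_q)
    (A : 'M[R]_q) : bijective h -> \det (mxsub h h A) = \det A.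
Proof.
move=> bij_h; have eq_pq : p = q.
  by have := bij_eq_card bij_h; rewrite !card_ord.
case: _ / eq_pq in h A bij_h *.
pose s := perm (bij_inj bij_h).
have -> : mxsub h h A = row_perm s (col_perm s A).
  by apply/matrixP => i j; rewrite !mxE !permE.
rewrite row_permE col_permE !det_mulmx !det_perm odd_permV.
by rewrite mulrC -mulrA -signr_addb addbb mulr1.
Qed.

(** One step of Gram-Schmidt: replacing x by its component y orthogonal to the
    columns of B is a unimodular column operation, after which the Gram matrix
    is block diagonal. *)
Lemma det_gram_row_mx (R : comNzRingType) (m p : nat) (x : 'cV[R]_m)
    (B : 'M[R]_(m, p)) (w : 'cV[R]_p) :
  let y := x - B *m w in
  B^T *m y = 0 ->
  \det ((row_mx x B)^T *m row_mx x B) = (y^T *m y) 0 0 * \det (B^T *m B).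
Proof.
move=> y By0; have yB0 : y^T *m B = 0 by rewrite -[B]trmxK -trmx_mul By0 trmx0.
have -> : row_mx x B = row_mx y B *m block_mx 1%:M 0 w 1%:M.
  by rewrite mul_row_block !mulmx1 mulmx0 add0r subrK.
rewrite trmx_mul -mulmxA (mulmxA (row_mx y B)^T) !det_mulmx det_tr.
rewrite det_lblock !det1 mulr1 mul1r mulr1 tr_row_mx mul_col_row By0 yB0.
by rewrite det_ublock det_mx11.
Qed.

(** * Projectors onto spans of columns *)

Section EuclideanNorm.
Variables (R : realType) (m : nat).
Implicit Types v : 'cV[R]_m.

Lemma sqr_enorm v : enorm v ^+ 2 = (v^T *m v) 0 0.
Proof.
rewrite /enorm sqr_sqrtr; last by rewrite sumr_ge0 // => i _; rewrite sqr_ge0.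
by rewrite mxE; apply: eq_bigr => i _; rewrite !mxE expr2.
Qed.

Lemma enorm_ge0 v : 0 <= enorm v.
Proof. exact: sqrtr_ge0. Qed.

Lemma enorm_eq0 v : enorm v = 0 -> v = 0.
Proof.
move=> v0; have sum0 : \sum_i v i 0 ^+ 2 = 0.
  transitivity (enorm v ^+ 2); last by rewrite v0 expr0n.
  by rewrite sqr_enorm mxE; apply: eq_bigr => i _; rewrite !mxE expr2.
apply/colP => i; rewrite !mxE; apply/eqP; rewrite -sqrf_eq0; apply/eqP.
by apply: (psumr_eq0P _ sum0) => // j _; rewrite sqr_ge0.
Qed.

End EuclideanNorm.

Section SpanProjector.
Variables (R : realType) (m n : nat) (X : 'M[R]_(m, n)).
Implicit Types (S : {set 'I_n}) (P : 'M[R]_m).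

(** The orthogonal projector onto the span of the columns x_i, i in S.  That its
    range lies in this span is expressed by a coefficient matrix W with all n
    rows, vanishing off S, which avoids matrices whose size depends on S. *)
Definition span_projector S P : Prop :=
  [/\ P^T = P, forall i, i \in S -> P *m col i X = col i X
    & exists2 W : 'M_(n, m), P = X *m W & forall i, i \notin S -> row i W = 0].

(** P' fixes the columns in S' and P is a combination of the columns in S.  With
    S = S' this is idempotence. *)
Lemma span_projector_absorb S S' P P' : S \subset S' ->
  span_projector S P -> span_projector S' P' -> P' *m P = P.
Proof.
move=> sSS' [_ _ [W -> W0]] [_ fixP' _]; rewrite mulmxA.
apply/matrixP => a b; rewrite !mxE; apply: eq_bigr => i _.
have [Si | nSi] := boolP (i \in S); last first.
  by have /rowP/(_ b) := W0 i nSi; rewrite !mxE => ->; rewrite !mulr0.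
congr (_ * _); have : col i (P' *m X) a 0 = col i X a 0.
  by rewrite colE -mulmxA -colE fixP' ?(subsetP sSS').
by rewrite mxE => ->; rewrite mxE.
Qed.

(** (1 - P') x is z - P' z for z = (1 - P) x, and projecting cannot lengthen z,
    by Pythagoras. *)
Lemma enorm_complement_sub S S' P P' (x : 'cV[R]_m) : S \subset S' ->
  span_projector S P -> span_projector S' P' ->
  enorm ((1%:M - P') *m x) <= enorm ((1%:M - P) *m x).
Proof.
move=> sSS' projP projP'; have P'P := span_projector_absorb sSS' projP projP'.
have P'P' := span_projector_absorb (subxx _) projP' projP'.
have [symP' _ _] := projP'; set z := (1%:M - P) *m x.
have -> : (1%:M - P') *m x = z - P' *m z.
  by rewrite /z !mulmxBl !mul1mx mulmxBr mulmxA P'P opprB addrA subrK.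
clearbody z; rewrite -(ler_pXn2r (n := 2)) ?nnegrE ?enorm_ge0 // !sqr_enorm.
have -> : ((z - P' *m z)^T *m (z - P' *m z)) 0 0 =
    (z^T *m z) 0 0 - ((P' *m z)^T *m (P' *m z)) 0 0.
  have -> : (z - P' *m z)^T *m (z - P' *m z) =
      z^T *m z - (P' *m z)^T *m (P' *m z).
    have -> : (z - P' *m z)^T = z^T - z^T *m P'.
      by rewrite linearB /= trmx_mul symP'.
    rewrite trmx_mul symP' !mulmxBl !mulmxBr !mulmxA.
    by rewrite -(mulmxA z^T P' P') P'P' subrr subr0.
  by rewrite mxE [X in _ + X]mxE.
by rewrite gerBl -sqr_enorm sqr_ge0.
Qed.

Lemma span_projector0 : span_projector set0 0.
Proof.
split; [exact: trmx0 | by move=> i; rewrite inE |].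
by exists 0 => [|i _]; rewrite ?mulmx0 ?row0.
Qed.

(** The residual y is orthogonal to the span so far, so adding y y^T / |y|^2
    extends the projector to the new column.  If y = 0 the new column already
    lies in the span and the update adds 0, as 0^-1 = 0. *)
Lemma bg_step_projector (st : bg_state R m n) t :
  span_projector (bgS st) (bgP st) ->
  span_projector (bgS (bg_step X st t)) (bgP (bg_step X st t)).
Proof.
case: st => P S T /= projP.
have PP := span_projector_absorb (subxx _) projP projP.
have [symP fixP [W defP W0]] := projP.
rewrite /bg_residual /= /dagger sqr_enorm; set x := col t X; set y := _ *m x.
set q := (y^T *m y) 0 0.
have yT : y^T = x^T *m (1%:M - P) by rewrite trmx_mul linearB /= trmx1 symP.
have CC : (1%:M - P) *m (1%:M - P) = 1%:M - P.
  by rewrite mulmxBl mul1mx mulmxBr mulmx1 PP subrr subr0.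
have y_x : y^T *m x = y^T *m y.
  by rewrite yT -!mulmxA [in RHS]/y [in RHS](mulmxA _ _ x) CC.
split.
- by rewrite linearD /= symP -scalemxAr linearZ /= trmx_mul trmxK.
- move=> i; rewrite !inE => /orP[/eqP-> | Si];
  rewrite mulmxDl -mulmxA -scalemxAl -/x.
    have [q0 | q_neq0] := eqVneq q 0.
      have y0 : y = 0.
        by apply/enorm_eq0/eqP; rewrite -sqrf_eq0 sqr_enorm -/q q0.
      rewrite y0 mul0mx addr0; apply/esym/subr0_eq.
      by rewrite -y0 /y mulmxBl mul1mx.
    rewrite y_x [_ *m y]mx11_scalar -/q scale_scalar_mx mulVf // mulmx1.
    by rewrite /y mulmxBl mul1mx addrC subrK.
  rewrite yT -mulmxA mulmxBl mul1mx fixP // subrr.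
  by rewrite mulmx0 scaler0 mulmx0 addr0.
- exists (W + (delta_mx t 0 - W *m x) *m (q^-1 *: y^T)).
    rewrite mulmxDr -defP mulmxA mulmxBr -colE mulmxA -defP -/x.
    by rewrite /y mulmxBl mul1mx.
  move=> i; rewrite !inE negb_or => /andP[nti nSi].
  rewrite linearD /= W0 // add0r row_mul linearB /= row_mul W0 // mul0mx subr0.
  rewrite (_ : row i _ = 0) ?mul0mx //.
  by apply/rowP => j; rewrite !mxE (negPf nti).
Qed.

End SpanProjector.

(** * Volumes of column submatrices *)

Section Volume.
Variables (R : realType) (m n : nat) (X : 'M[R]_(m, n)).
Implicit Types (S : {set 'I_n}) (P : 'M[R]_m).

(** The volume does not depend on the order in which the columns are listed. *)
Lemma vol_colsub (p : nat) (g : 'I_p -> 'I_n) S :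
  injective g -> g @: setT = S -> vol (colsub g X) = vol (colsubmx X S).
Proof.
move=> inj_g <-; set S' := g @: setT.
have gS a : g a \in S' by rewrite imset_f.
pose h a : 'I_#|S'| := enum_rank_in (gS a) (g a).
have hK a : enum_val (h a) = g a by rewrite enum_rankK_in.
have inj_h : injective h.
  by move=> a b /(congr1 enum_val); rewrite !hK => /inj_g.
have bij_h : bijective h.
  apply: inj_card_bij inj_h _.
  by rewrite !card_ord card_imset // cardsT card_ord.
rewrite /vol -(det_mxsub_bij _ bij_h); congr (Num.sqrt (\det _)).
apply/matrixP => a b; rewrite !mxE; apply: eq_bigr => c _.
by rewrite !mxE !hK.
Qed.

(** Base times height: the residual is the component of the new column
    orthogonal to the others. *)
Lemma vol_setU1 S P i : i \notin S -> span_projector X S P ->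
  vol (colsubmx X (i |: S)) =
    enorm ((1%:M - P) *m col i X) * vol (colsubmx X S).
Proof.
move=> nSi [symP fixP [W defP W0]].
(* Listing i first instead of in increasing order gives a block row matrix. *)
pose g (a : 'I_(1 + #|S|)) : 'I_n :=
  if split a is inr b then enum_val b else i.
have gl a : g (lshift _ a) = i by rewrite /g (unsplitK (inl _)).
have gr b : g (rshift _ b) = enum_val b by rewrite /g (unsplitK (inr _)).
have <- : vol (colsub g X) = vol (colsubmx X (i |: S)).
  apply: vol_colsub.
    move=> a b; case: (split_ordP a) => a' ->; case: (split_ordP b) => b' ->.
    - by rewrite !ord1.
    - by rewrite gl gr => def_i; rewrite def_i enum_valP in nSi.
    - by rewrite gl gr => def_i; rewrite -def_i enum_valP in nSi.
    - by rewrite !gr => /enum_val_inj->.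
  apply/setP => j; rewrite !inE; apply/imsetP/orP => [[a _ ->] | [/eqP-> | Sj]].
  - by case: (split_ordP a) => b ->; rewrite ?gl ?gr ?eqxx ?enum_valP;
      [left | right].
  - by exists (lshift _ ord0); rewrite ?gl.
  - by exists (rshift 1 (enum_rank_in Sj j)); rewrite ?gr ?enum_rankK_in.
have -> : colsub g X = row_mx (col i X) (colsubmx X S).
  apply/matrixP => a b; rewrite mxE.
  by case: (split_ordP b) => b' ->; rewrite ?gl ?gr ?row_mxEl ?row_mxEr !mxE.
pose w := \col_(b < #|S|) (W *m col i X) (enum_val b) 0.
have projE : (1%:M - P) *m col i X = col i X - colsubmx X S *m w.
  rewrite mulmxBl mul1mx defP -mulmxA; congr (_ - _).
  apply/colP => a; rewrite mxE [RHS]mxE (bigID (mem S)) /= addrC big1 ?add0r.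
    by rewrite big_enum_val; apply: eq_bigr => b _; rewrite !mxE.
  move=> j nSj; have := row_mul j W (col i X).
  rewrite W0 // mul0mx => /rowP/(_ 0); rewrite mxE [in RHS]mxE => ->.
  by rewrite mulr0.
have orth : (colsubmx X S)^T *m (col i X - colsubmx X S *m w) = 0.
  rewrite -projE mulmxA -[RHS](mul0mx _ (col i X)); congr (_ *m _).
  rewrite -[1%:M - P]trmxK -trmx_mul linearB /= trmx1 symP -trmx0; congr (_^T).
  apply/matrixP => a b; rewrite mulmxBl mul1mx.
  have /colP/(_ a) := fixP _ (enum_valP b); rewrite !mxE => PX.
  apply/eqP; rewrite subr_eq0 -[X in X == _]PX; apply/eqP/eq_bigr => j _.
  by rewrite !mxE.
rewrite /vol (det_gram_row_mx orth) -projE -sqr_enorm sqrtrM ?sqr_ge0 //.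
by rewrite sqrtr_sqr ger0_norm ?enorm_ge0.
Qed.

Lemma vol_set0 : vol (colsubmx X set0) = 1.
Proof.
suff det1_0 p (A : 'M[R]_p) : p = 0 -> \det A = 1.
  by rewrite /vol det1_0 ?cards0 // sqrtr1.
by move=> p0; case: _ / (esym p0) in A *; exact: det_mx00.
Qed.

Lemma vol_orthonormal S : X^T *m X = 1%:M -> vol (colsubmx X S) = 1.
Proof.
move=> XTX; rewrite /vol (_ : _ *m _ = 1%:M) ?det1 ?sqrtr1 //.
apply/matrixP => a b; have /matrixP/(_ (enum_val a) (enum_val b)) := XTX.
rewrite !mxE (inj_eq enum_val_inj) => <-.
by apply: eq_bigr => c _; rewrite !mxE.
Qed.

Lemma bg_after_rcons (s : seq 'I_n) i :
  bg_after X (rcons s i) = bg_step X (bg_after X s) i.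
Proof. exact: foldl_rcons. Qed.

Lemma bgS_after (s : seq 'I_n) : bgS (bg_after X s) = [set i in s].
Proof.
elim/last_ind: s => [|s i IHs]; first by apply/setP => i; rewrite !inE.
by rewrite bg_after_rcons /= IHs; apply/setP => j; rewrite !inE mem_rcons.
Qed.

Lemma bgT_after (s : seq 'I_n) : bgT (bg_after X s) = ~: bgS (bg_after X s).
Proof.
elim/last_ind: s => [|s i IHs]; first by rewrite setC0.
by rewrite bg_after_rcons /= IHs; apply/setP => j; rewrite !inE negb_or.
Qed.

Lemma bg_after_projector (s : seq 'I_n) :
  span_projector X (bgS (bg_after X s)) (bgP (bg_after X s)).
Proof.
elim/last_ind: s => [|s i IHs]; first exact: span_projector0.
by rewrite bg_after_rcons; exact: bg_step_projector.
Qed.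

(** Running the algorithm's update on any enumeration of S, without regard to
    the pivot rule, is Gram-Schmidt. *)
Lemma span_projector_exists S : exists P, span_projector X S P.
Proof.
exists (bgP (bg_after X (enum S))).
by have := bg_after_projector (enum S); rewrite bgS_after set_enum.
Qed.

End Volume.

(** * The log-volume is monotone and submodular *)

Section Expansive.
Variables (R : realType) (m n : nat) (X : 'M[R]_(m, n)).
Hypothesis expandX : forall u : 'cV[R]_n, enorm u <= enorm (X *m u).
Implicit Types (S : {set 'I_n}) (P : 'M[R]_m).

(** The residual is X u for a vector u whose i-th coordinate is 1, since the
    projection of x_i only involves other columns. *)
Lemma enorm_residual_ge1 S P i : i \notin S -> span_projector X S P ->
  1 <= enorm ((1%:M - P) *m col i X).
Proof.
move=> nSi [_ _ [W defP W0]]; pose u := delta_mx i 0 - W *m col i X.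
have -> : (1%:M - P) *m col i X = X *m u.
  by rewrite mulmxBl mul1mx mulmxBr -colE defP mulmxA.
have ui : u i 0 = 1.
  have := row_mul i W (col i X); rewrite W0 // mul0mx => /rowP/(_ 0).
  rewrite mxE [in RHS]mxE => Wx.
  by rewrite mxE [X in _ + X]mxE Wx mxE !eqxx subr0.
apply: le_trans (expandX u).
rewrite -(ler_pXn2r (n := 2)) ?nnegrE ?enorm_ge0 //.
rewrite sqr_enorm mxE (bigD1 i) //= mxE ui mulr1 expr1n lerDl.
rewrite sumr_ge0 // => j _.
by rewrite mxE -expr2 sqr_ge0.
Qed.

Lemma vol_gt0 S : 0 < vol (colsubmx X S).
Proof.
rewrite -(set_enum S); elim: (enum S) => [|i s IHs].
  by rewrite set_nil vol_set0.
rewrite set_cons; have [si | nsi] := boolP (i \in [set x in s]).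
  by rewrite (setUidPr _) ?sub1set.
have [P projP] := span_projector_exists X [set x in s].
rewrite (vol_setU1 nsi projP) mulr_gt0 //.
by rewrite (lt_le_trans ltr01) ?(enorm_residual_ge1 nsi).
Qed.

Lemma logvol_setU1 S P i : i \notin S -> span_projector X S P ->
  logvol (colsubmx X (i |: S)) =
    logvol (colsubmx X S) + ln (enorm ((1%:M - P) *m col i X)).
Proof.
move=> nSi projP.
rewrite /logvol (vol_setU1 nSi projP) [RHS]addrC lnM ?posrE ?vol_gt0 //.
exact: lt_le_trans ltr01 (enorm_residual_ge1 nSi projP).
Qed.

Lemma logvol_monotone S i :
  logvol (colsubmx X S) <= logvol (colsubmx X (i |: S)).
Proof.
have [Si | nSi] := boolP (i \in S); first by rewrite (setUidPr _) ?sub1set.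
have [P projP] := span_projector_exists X S.
by rewrite (logvol_setU1 nSi projP) lerDl ln_ge0 // (enorm_residual_ge1 nSi).
Qed.

(** A larger set leaves a shorter residual, hence a smaller gain. *)
Lemma logvol_submodular S S' i : S \subset S' -> i \notin S' ->
  logvol (colsubmx X (i |: S')) - logvol (colsubmx X S') <=
    logvol (colsubmx X (i |: S)) - logvol (colsubmx X S).
Proof.
move=> sSS' nSi'; have nSi : i \notin S := contra (subsetP sSS' i) nSi'.
have [P projP] := span_projector_exists X S.
have [P' projP'] := span_projector_exists X S'.
rewrite (logvol_setU1 nSi projP) (logvol_setU1 nSi' projP').
rewrite [leLHS]addrAC [leRHS]addrAC !subrr !add0r.
have res_gt0 (A : {set _}) Q (nAi : i \notin A) (projQ : span_projector X A Q) :=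
  lt_le_trans ltr01 (enorm_residual_ge1 nAi projQ).
rewrite ler_ln ?posrE; first exact: enorm_complement_sub sSS' projP projP'.
- exact: res_gt0 nSi' projP'.
- exact: res_gt0 nSi projP.
Qed.

(** The gains are the logarithms of the residual norms compared by the pivot
    rule. *)
Lemma bg_pivot_logvol_max (s : seq 'I_n) t :
  let S := bgS (bg_after X s) in
  bg_pivot X (bg_after X s) t ->
  t \notin S /\ forall i, i \notin S ->
    logvol (colsubmx X (i |: S)) <= logvol (colsubmx X (t |: S)).
Proof.
move=> S [Tt maxt]; have projP := bg_after_projector X s.
have inT i : (i \in bgT (bg_after X s)) = (i \notin S) by rewrite bgT_after inE.
have nSt : t \notin S by rewrite -inT.
split=> // i nSi; have res_gt0 j nSj :=
  lt_le_trans ltr01 (@enorm_residual_ge1 S _ j nSj projP).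
rewrite (logvol_setU1 nSi projP) (logvol_setU1 nSt projP) lerD2l.
by rewrite ler_ln ?posrE ?res_gt0 //; apply: maxt; rewrite inT.
Qed.

End Expansive.

(** The eigenvalues of X^T X are the sigma_i^2 >= 1, and |X u|^2 is its
    quadratic form at u. *)
Lemma singular_values_ge1_expand (R : realType) (m n : nat) (X : 'M[R]_(m, n))
    (sigma : 'I_n -> R) :
  singular_values X sigma -> (forall i, 1 <= sigma i) ->
  forall u : 'cV[R]_n, enorm u <= enorm (X *m u).
Proof.
move=> [_ _ charX] sigma_ge1 u.
rewrite -(ler_pXn2r (n := 2)) ?nnegrE ?enorm_ge0 // !sqr_enorm.
rewrite trmx_mul mulmxA -(mulmxA u^T) -[leLHS]mul1r; apply: ler_rayleigh_root.
  by rewrite trmx_mul trmxK.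
move=> a; rewrite charX rootE horner_prod => /prodf_eq0[i _].
by rewrite hornerXsubC subr_eq0 => /eqP->; rewrite expr_ge1 // (le_trans ler01).
Qed.

Theorem theorem4p1 (R : realType) (m n k : nat) (X : 'M[R]_(m, n))
    (sigma : 'I_n -> R) (Sopt : {set 'I_n}) (t : k.-tuple 'I_n)
    (rankX : \rank X = n)
    (sigmaX : singular_values X sigma)
    (sigma_ge1 : forall i, 1 <= sigma i)
    (k_bounds : (0 < k < n)%N)
    (SoptP : max_logvol X k Sopt)
    (tP : businger_golub X t) :
  let Xopt := colsubmx X Sopt in
  let Xk := colsubmx X (bgS (bg_after X t)) in
  let c : R := (1 - k%:R^-1) ^+ k in
  [/\ forall j : 'I_k,
        let S := bgS (bg_after X (take j t)) in
        tnth t j \notin S /\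
        forall i : 'I_n, i \notin S ->
          logvol (colsubmx X (i |: S)) <= logvol (colsubmx X (tnth t j |: S)),
      0 <= logvol Xopt - logvol Xk <= c * logvol Xopt,
      c <= (expR (1 : R))^-1 < 37 / 100
    & X^T *m X = 1%:M -> logvol Xopt - logvol Xk = c * logvol Xopt].
Proof.
move=> Xopt Xk c; have /andP[k_gt0 _] := k_bounds.
have [cardSopt Sopt_max] := SoptP.
have expandX := singular_values_ge1_expand sigmaX sigma_ge1.
pose S (j : nat) := bgS (bg_after X (take j t)).
have greedy j := bg_pivot_logvol_max expandX (tP j).
have S_succ (j : 'I_k) : S j.+1 = tnth t j |: S j.
  by rewrite /S (take_nth (tnth t j)) ?size_tuple // -tnth_nth bg_after_rcons.
have Sk : S k = bgS (bg_after X t) by rewrite /S take_oversize ?size_tuple.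
(* Optimality of Sopt only speaks of sets of size k: no index repeats. *)
have cardS j : (j <= k)%N -> #|S j| = j.
  elim: j => [|j IHj] le_jk; first by rewrite /S take0 cards0.
  rewrite (S_succ (Ordinal le_jk)) cardsU1 IHj 1?ltnW //.
  by have [-> _] := greedy (Ordinal le_jk).
have F0 : logvol (colsubmx X set0) = 0 by rewrite /logvol vol_set0 ln1.
split=> //.
- apply/andP; split; first by rewrite subr_ge0 Sopt_max // -Sk cardS.
  rewrite /Xk -Sk; pose F A := logvol (colsubmx X A).
  apply: (@greedy_gap _ _ F) => //.
  + exact: logvol_monotone.
  + by move=> *; apply: logvol_submodular.
  + by rewrite /S take0.
  + move=> j i lt_jk; have [_ max_j] := greedy (Ordinal lt_jk).
    rewrite (S_succ (Ordinal lt_jk)).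
    have [Si | nSi] := boolP (i \in S j); last exact: max_j.
    by rewrite (setUidPr _) ?sub1set //; apply: logvol_monotone.
- (* 37/100 is written as the inverse of 100/37 to compare denominators. *)
  rewrite pow_one_sub_inv_le //= -[ltRHS]invrK invf_div.
  by rewrite ltf_pV2 ?posrE ?expR_gt0 ?expR1_gt ?divr_gt0 ?ltr0n.
- by move=> XTX; rewrite /logvol !vol_orthonormal // ln1 subrr mulr0.
Qed.
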